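(* Let $n\ge1$ be an integer and $0<\alpha<1/3$. Then $$M_{\alpha,n}:=\inf_{\mathrm{CI}\in\mathcal I_{\alpha,n}}\ \sup_{P\in\mathcal N}\ \sigma^{-1}(P)\cdot W_\alpha(\mathrm{CI},P)\ \ge\ \sqrt{(6\alpha-9\alpha^2)^{-2/n}-1}.$$
   Context: $\mathcal N=\{N(\mu,\sigma^2):\mu\in\mathbb R,\sigma>0\}$; for $P=N(\mu,\sigma^2)\in\mathcal N$ write $\mu(P)=\mu$, $\sigma(P)=\sigma$. $X_1,\dots,X_n$ are i.i.d. from $P$, and $P(\cdot)$ denotes probability under this sampling. $\mathcal I_{\alpha,n}$ is the set of all two-sided $(1-\alpha)$-confidence intervals for the mean over $\mathcal N$ with sample size $n$: pairs of measurable functions $L,U:\mathbb R^n\to\mathbb R$ giving $\mathrm{CI}=[L(X_1,\dots,X_n),U(X_1,\dots,X_n)]$ such that $P(L(X_1,\dots,X_n)\le\mu(P)\le U(X_1,\dots,X_n))\ge1-\alpha$ for all $P\in\mathcal N$. $W_\varepsilon(\mathrm{CI},P)$ is the $\varepsilon$-upper quantile under $P$ of the width $|\mathrm{CI}|=U(X_1,\dots,X_n)-L(X_1,\dots,X_n)$, namely $\sup\{w\in\mathbb R:P(|\mathrm{CI}|\ge w)\ge\varepsilon\}$. *)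

(* Defs.v *)
From HB Require Import structures.
From mathcomp Require Import all_boot all_order all_algebra.
From mathcomp Require Import all_classical all_reals all_analysis.

Set Implicit Arguments.
Unset Strict Implicit.
Unset Printing Implicit Defensive.

Import Order.TTheory GRing.Theory Num.Theory.
Import numFieldNormedType.Exports.

Local Open Scope classical_set_scope.
Local Open Scope ring_scope.
Local Open Scope ereal_scope.

Section iid_sample.
Context {d : measure_display} {T : measurableType d} {R : realType}.

Definition tuple_cons (n : nat) (x : T * n.-tuple T) : n.+1.-tuple T :=
  [the n.+1.-tuple T of x.1 :: x.2].

Lemma measurable_tuple_cons n : measurable_fun setT (@tuple_cons n).
Proof. exact: measurable_cons. Qed.

HB.instance Definition _ n := @isMeasurableFun.Build _ _ _ _ (@tuple_cons n)
  (@measurable_tuple_cons n).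

(* The joint law of n independent draws from P, i.e. the n-fold product
   measure, carried by the product sigma-algebra of n.-tuple T; see iid_lawX. *)
Fixpoint iid_law (P : probability T R) (n : nat) : probability (n.-tuple T) R :=
  match n with
  | 0%N => dirac [tuple]
  | m.+1 => distribution (P \x iid_law P m) (@tuple_cons m)
  end.

Lemma iid_lawX (P : probability T R) n (A : 'I_n -> set T) :
  (forall i, measurable (A i)) ->
  iid_law P n [set x | forall i, A i (tnth x i)] = \prod_(i < n) P (A i).
Proof.
elim: n A => [|n IH] A mA.
  by rewrite big_ord0 /= diracE mem_set//= => -[].
rewrite big_ord_recl /= /distribution /pushforward.
have -> : (@tuple_cons n) @^-1` [set x | forall i, A i (tnth x i)] =
    A ord0 `*` [set x | forall i, A (lift ord0 i) (tnth x i)].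
  apply/seteqP; split => -[x t] /=.
    move=> H; split; first exact: (H ord0).
    by move=> i; have := H (lift ord0 i); rewrite /tuple_cons tnthS.
  move=> [Ax At] i; case: (unliftP ord0 i) => [j|] ->.
    by rewrite /tuple_cons tnthS.
  exact: Ax.
rewrite product_measure1E//=; first by rewrite (IH (fun i => A (lift ord0 i))).
rewrite (_ : [set _ | _] =
    \bigcap_(i in [set: 'I_n]) ((@tnth n T ^~ i) @^-1` A (lift ord0 i))).
  apply: fin_bigcap_measurable => // i _; rewrite -[X in measurable X]setTI.
  by apply: measurable_tnth.
by apply/seteqP; split => [x H i _|x H i]; exact: H.
Qed.

End iid_sample.

(* N(mean, sd^2). *)
Record normal_law (R : realType) := NormalLaw {
  mean : R;
  sd : R;
  sd_gt0 : (0 < sd)%R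
}.

Section confidence_intervals.
Context {R : realType}.

Local Notation Rn n := (n.-tuple (measurableTypeR R)).

(* The probability P(.) on R^n of an i.i.d. sample X_1, ..., X_n from P. *)
Definition sample_law (n : nat) (P : normal_law R) : probability (Rn n) R :=
  iid_law (normal_prob (mean P) (sd P)) n.

(* The pair (L, U) stands for the interval [L(X), U(X)]; L <= U is not
   required pointwise. *)
Definition interval_rule (n : nat) : Type := ((Rn n -> R) * (Rn n -> R))%type.

Definition conf_intervals (alpha : R) (n : nat) : set (interval_rule n) :=
  [set CI : interval_rule n | [/\ measurable_fun [set: Rn n] CI.1,
                measurable_fun [set: Rn n] CI.2 &
                forall P : normal_law R,
                  (1 - alpha)%:E <=
                  sample_law n P [set x | (CI.1 x <= mean P <= CI.2 x)%R]]].

Definition width (n : nat) (CI : interval_rule n) (x : Rn n) : R :=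
  (CI.2 x - CI.1 x)%R.

Definition width_quantile (eps : R) (n : nat) (CI : interval_rule n)
    (P : normal_law R) : \bar R :=
  ereal_sup [set w%:E | w in
    [set w : R | eps%:E <= sample_law n P [set x | (w <= width CI x)%R]]].

Definition minimax_width (alpha : R) (n : nat) : \bar R :=
  ereal_inf [set ereal_sup [set (sd P)^-1%:E * width_quantile alpha CI P
                           | P in [set: normal_law R]]
            | CI in @conf_intervals alpha n].

End confidence_intervals.

Arguments conf_intervals {R} alpha n _.

(* Main.v *)
(** For [w] below the claimed bound, compare [P2 = N(0, 1)] with
    [P1 = N(w, 1 + w^2)].  If the width exceeds [w] with [P2]-probability less
    than [alpha], the event "the interval contains [w]" has [P1]-probability at
    least [1 - alpha] and [P2]-probability at most [2 alpha], since under [P2]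
    the interval contains [0] and is shorter than [w] outside an event of
    probability [2 alpha].  Hence the two sampling laws are at total variation
    distance at least [1 - 3 alpha].  On the other hand their squared
    Bhattacharyya affinity is [C^n] with [C >= (1 + w^2)^(-1/2)], and the
    distance is at most [sqrt (1 - C^n)], so
    [(1 + w^2)^(-n/2) <= 1 - (1 - 3 alpha)^2 = 6 alpha - 9 alpha^2],
    contradicting the choice of [w].  To avoid densities on [R^n], the affinity
    is tensorized through the law [Q] proportional to [sqrt (p1 p2)], which is
    again Gaussian. *)

Require Import Defs.
From mathcomp Require Import all_boot all_order all_algebra.
From mathcomp Require Import all_classical all_reals all_analysis.
From mathcomp Require Import measurable_realfun ring lra.

Set Implicit Arguments.
Unset Strict Implicit.
Unset Printing Implicit Defensive.

Import Order.TTheory GRing.Theory Num.Theory.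

Local Open Scope classical_set_scope.
Local Open Scope ring_scope.

(** * Elementary real inequalities *)

(** For positive [a] and [c] the scale [t = c / a] turns the hypothesis into
    [2 c <= c + a b / c]. *)
Lemma sqr_le_mul_of_scaled_AMGM (R : realFieldType) (a b c : R) :
  0 <= a -> 0 <= b -> 0 <= c ->
  (forall t, 0 < t -> 2 * c <= t * a + t^-1 * b) -> c ^+ 2 <= a * b.
Proof.
move=> a0 b0; rewrite le_eqVlt => /predU1P[<- _|c0 H].
  by rewrite expr0n mulr_ge0.
move: a0; rewrite le_eqVlt => /predU1P[a0|a0].
  (* When [a = 0] this scale makes the right-hand side smaller than [c], which is absurd. *)
  have t0 : 0 < (b + 1) / c by rewrite divr_gt0// ltr_wpDl.
  have := H _ t0; rewrite -a0 mulr0 add0r invf_div.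
  have -> : c / (b + 1) * b = c - c / (b + 1).
    by field; rewrite gt_eqF// ltr_wpDl.
  have : 0 < c / (b + 1) by rewrite divr_gt0// ltr_wpDl.
  lra.
have := H _ (divr_gt0 c0 a0); rewrite divfK ?gt_eqF// invf_div.
have -> : 2 * c = c + c by ring.
by rewrite lerD2l mulrAC ler_pdivlMr// -expr2.
Qed.

Lemma scaled_AMGM (R : realFieldType) (f g c t : R) :
  0 <= f -> 0 <= g -> 0 < t -> c ^+ 2 <= f * g ->
  2 * c <= t * f + t^-1 * g.
Proof.
move=> f0 g0 t0 H.
have s0 : 0 <= t * f + t^-1 * g.
  by rewrite addr_ge0 ?mulr_ge0 ?invr_ge0// ltW.
rewrite (le_trans (ler_norm _))// -ler_sqr ?nnegrE// ?normr_ge0//.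
rewrite real_normK ?num_real//.
have -> : (t * f + t^-1 * g) ^+ 2 = (t * f - t^-1 * g) ^+ 2 + 4 * (f * g).
  by field; rewrite gt_eqF.
have := sqr_ge0 (t * f - t^-1 * g).
have -> : (2 * c) ^+ 2 = 4 * c ^+ 2 by ring.
lra.
Qed.

(** Here [a], [b], [q] stand for the masses that [P1], [P2], [Q] give to one event. Expand
    [k = k (q + (1 - q))^2]: the hypotheses bound the two squares, and AM-GM applied to their
    product bounds the cross term. *)
Lemma sqr_sub_le_of_affinity (R : realFieldType) (a b q k : R) :
  0 <= a <= 1 -> 0 <= b <= 1 -> 0 <= q <= 1 -> 0 <= k ->
  k * q ^+ 2 <= a * b -> k * (1 - q) ^+ 2 <= (1 - a) * (1 - b) ->
  k <= 1 - (a - b) ^+ 2.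
Proof.
move=> /andP[a0 a1] /andP[b0 b1] /andP[q0 q1] k0 H1 H2.
have a'0 : 0 <= 1 - a by lra.
have b'0 : 0 <= 1 - b by lra.
have q'0 : 0 <= 1 - q by lra.
have cross : 2 * (k * q * (1 - q)) <= a * (1 - a) + b * (1 - b).
  have := @scaled_AMGM _ (a * (1 - a)) (b * (1 - b)) (k * q * (1 - q)) 1.
  rewrite invr1 !mul1r; apply; rewrite ?mulr_ge0//.
  rewrite [leLHS](_ : _ = (k * q ^+ 2) * (k * (1 - q) ^+ 2)); last by ring.
  rewrite [leRHS](_ : _ = (a * b) * ((1 - a) * (1 - b))); last by ring.
  by apply: ler_pM => //; rewrite mulr_ge0// sqr_ge0.
have -> : 1 - (a - b) ^+ 2 =
  a * b + (1 - a) * (1 - b) + (a * (1 - a) + b * (1 - b)) by ring.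
have -> : k = k * q ^+ 2 + k * (1 - q) ^+ 2 + 2 * (k * q * (1 - q)) by ring.
by rewrite lerD// lerD.
Qed.

(* The squared Bhattacharyya affinity of [P1] and [P2] is at least [C], as
   witnessed by [Q] in the role of the law proportional to [sqrt (p1 p2)]; the
   constant [k] absorbs the bound obtained on the remaining coordinates when
   integrating over one of them. *)
Definition affinity_ge d (T : measurableType d) (R : realType)
    (P1 P2 Q : probability T R) (C : R) : Prop :=
  forall (k : R) (f g h : T -> R), 0 <= k ->
  measurable_fun setT f -> measurable_fun setT g -> measurable_fun setT h ->
  (forall x, 0 <= f x <= 1) -> (forall x, 0 <= g x <= 1) ->
  (forall x, 0 <= h x <= 1) -> (forall x, k * h x ^+ 2 <= f x * g x) ->
  (C * k) * (\int[Q]_x h x) ^+ 2 <= (\int[P1]_x f x) * (\int[P2]_x g x).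

(** * Affinity of Gaussian laws on the line *)

Section density.
Context {R : realType}.
Notation mu := (@lebesgue_measure R).

Lemma integrable_unit_valued d (T : measurableType d) (P : probability T R)
    (f : T -> R) :
  measurable_fun setT f -> (forall x, 0 <= f x <= 1) ->
  P.-integrable setT (EFin \o f).
Proof.
move=> mf f01; apply: (@le_integrable _ _ _ _ _ _ _ (cst 1%E)) => //.
- exact/measurable_EFinP.
- move=> x _ /=; have /andP[f0 f1] := f01 x.
  by rewrite normr1 ger0_norm ?lee_fin.
- by apply/finite_measure_integrable_cst.
Qed.

Lemma integrable_mul_normal_pdf (m s : R) (f : R -> R) :
  measurable_fun setT f -> (forall x, 0 <= f x <= 1) ->
  mu.-integrable setT (EFin \o (fun x => f x * normal_pdf m s x)).
Proof.
move=> mf f01.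
apply: (@le_integrable _ _ _ _ _ _ _ _ _ _ (integrable_normal_pdf m s)) => //.
  by apply/measurable_EFinP/measurable_funM => //; exact: measurable_normal_pdf.
move=> x _ /=; have /andP[f0 f1] := f01 x.
have p0 := normal_pdf_ge0 m s x.
by rewrite lee_fin !ger0_norm ?mulr_ge0// ler_piMl.
Qed.

Lemma Rintegral_normal_prob (m s : R) (f : R -> R) :
  measurable_fun setT f -> (forall x, 0 <= f x <= 1) ->
  \int[normal_prob m s]_x f x = \int[mu]_x (f x * normal_pdf m s x).
Proof.
move=> mf f01; congr fine.
have dom := @normal_prob_dominates R m s.
rewrite -(Radon_Nikodym_change_of_variables dom)//=; last first.
  exact: integrable_unit_valued.
under [RHS]eq_integral do rewrite EFinM.
apply: ae_eq_integral => //.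
- apply: emeasurable_funM; first exact/measurable_EFinP.
  exact: measurable_int (Radon_Nikodym_integrable _).
- apply: emeasurable_funM; apply/measurable_EFinP => //.
  exact: measurable_normal_pdf.
- apply: ae_eqe_mul2l.
  (* The Radon-Nikodym derivative and the density have equal integrals over every measurable set, so
     they agree almost everywhere. *)
  apply: integral_ae_eq => //=.
  + exact: Radon_Nikodym_integrable.
  + exact: measurable_int (integrable_normal_pdf m s).
  + by move=> E _ mE; rewrite -Radon_Nikodym_integral.
Qed.

(* Optimising [t f + g / t >= 2 sqrt (f g)] over the scale [t] after integration
   replaces the Cauchy-Schwarz inequality. *)
Lemma normal_affinity (m1 s1 m2 s2 m s C : R) : 0 <= C ->
  (forall x, C * normal_pdf m s x ^+ 2 <=
             normal_pdf m1 s1 x * normal_pdf m2 s2 x) ->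
  affinity_ge (normal_prob m1 s1) (normal_prob m2 s2) (normal_prob m s) C.
Proof.
move=> C0 pC k f g h k0 mf mg mh f01 g01 h01 fgh.
have Ck0 : 0 <= C * k by rewrite mulr_ge0.
have int0 (u s' : R) (e : R -> R) : (forall x, 0 <= e x <= 1) ->
    0 <= \int[normal_prob u s']_x e x.
  by move=> e01; apply: Rintegral_ge0 => x _; case/andP: (e01 x).
rewrite -{1}(sqr_sqrtr Ck0) -exprMn.
apply: sqr_le_mul_of_scaled_AMGM.
- exact: int0.
- exact: int0.
- by apply: mulr_ge0; [exact: sqrtr_ge0|exact: int0].
move=> t t0; rewrite !Rintegral_normal_prob//.
have iF := integrable_mul_normal_pdf m1 s1 mf f01.
have iG := integrable_mul_normal_pdf m2 s2 mg g01.
have iH := integrable_mul_normal_pdf m s mh h01.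
rewrite mulrA -!RintegralZl// -RintegralD//; last 2 first.
- exact: (integrableZl measurableT t iF).
- exact: (integrableZl measurableT t^-1 iG).
apply: le_Rintegral => //.
- exact: (integrableZl measurableT (2 * Num.sqrt (C * k)) iH).
- apply: (integrableD measurableT (integrableZl measurableT t iF)
                                  (integrableZl measurableT t^-1 iG)).
move=> x _; rewrite -mulrA.
have /andP[f0 f1] := f01 x; have /andP[g0 g1] := g01 x.
have p10 := normal_pdf_ge0 m1 s1 x; have p20 := normal_pdf_ge0 m2 s2 x.
apply: scaled_AMGM => //; rewrite ?mulr_ge0//.
rewrite exprMn sqr_sqrtr// exprMn mulrACA (mulrC C) (mulrACA (f x)).
rewrite [leLHS](_ : _ = (k * h x ^+ 2) * (C * normal_pdf m s x ^+ 2)).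
  by apply: ler_pM => //; rewrite mulr_ge0// sqr_ge0.
by ring.
Qed.

End density.

(** * Tensorization to product laws *)

Section iid_law_affinity.
Context d (T : measurableType d) (R : realType).

Lemma fine_iid_lawS (P : probability T R) n
    (A : set (n.+1.-tuple T)) : measurable A ->
  fine (iid_law P n.+1 A) =
  \int[P]_x fine (iid_law P n (xsection (@tuple_cons d T n @^-1` A) x)).
Proof.
move=> mA; congr fine; apply: eq_integral => x _ /=.
rewrite fineK// fin_num_measure//; apply: measurable_xsection.
by rewrite -[X in measurable X]setTI; exact: measurable_tuple_cons.
Qed.

Lemma iid_law_affinity (P1 P2 Q : probability T R) (C : R) n
    (A : set (n.-tuple T)) :
  0 <= C -> affinity_ge P1 P2 Q C -> measurable A ->
  C ^+ n * fine (iid_law Q n A) ^+ 2 <=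
  fine (iid_law P1 n A) * fine (iid_law P2 n A).
Proof.
move=> C0 PQ; elim: n A => [|n IH] A mA.
  by rewrite /= expr0 mul1r expr2.
have mB : measurable (@tuple_cons _ T n @^-1` A).
  by rewrite -[X in measurable X]setTI; exact: measurable_tuple_cons.
have msec (P : probability T R) : measurable_fun setT
    (fun x => fine (iid_law P n (xsection (@tuple_cons _ T n @^-1` A) x))).
  apply: (measurableT_comp (fine_measurable measurableT)).
  exact: measurable_fun_xsection.
have sec01 (P : probability T R) x :
    0 <= fine (iid_law P n (xsection (@tuple_cons _ T n @^-1` A) x)) <= 1.
  have mX := measurable_xsection x mB.
  rewrite fine_ge0//= -lee_fin fineK ?fin_num_measure//.
  exact: probability_le1.
(* [affinity_ge] is used with [k = C ^+ n] and with the section probabilities as [f], [g], [h]; the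
   induction hypothesis is its pointwise assumption. *)
rewrite !fine_iid_lawS// exprS; apply: PQ => //.
  by rewrite exprn_ge0.
by move=> x; apply: IH; exact: measurable_xsection.
Qed.

Lemma iid_law_sub_sqr_le (P1 P2 Q : probability T R) (C : R) n
    (A : set (n.-tuple T)) :
  0 <= C -> affinity_ge P1 P2 Q C -> measurable A ->
  C ^+ n <= 1 - (fine (iid_law P1 n A) - fine (iid_law P2 n A)) ^+ 2.
Proof.
move=> C0 PQ mA.
have fA (P : probability T R) : 0 <= fine (iid_law P n A) <= 1.
  rewrite fine_ge0//= -lee_fin fineK ?fin_num_measure//.
  exact: probability_le1.
have fAC (P : probability T R) :
    fine (iid_law P n (~` A)) = 1 - fine (iid_law P n A).
  by rewrite probability_setC// fineB// fin_num_measure.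
apply: (sqr_sub_le_of_affinity (fA P1) (fA P2) (fA Q)).
- exact: exprn_ge0.
- exact: iid_law_affinity.
- by rewrite -!fAC; apply: iid_law_affinity => //; exact: measurableC.
Qed.

End iid_law_affinity.

(** * The Gaussian affinity constant *)

Section normal_geometric_mean.
Context {R : realType}.
Implicit Types w r x : R.

(** For [r > 0], the squared Bhattacharyya affinity of [N(w, r^2)] and [N(0, 1)]. *)
Definition normal_affinity_const w r : R :=
  2 * r / (1 + r ^+ 2) * expR (- (w ^+ 2 / (2 * (1 + r ^+ 2)))).

Lemma normal_peakV r : 0 < r -> normal_peak r = r^-1 * normal_peak 1.
Proof.
move=> r0; rewrite /normal_peak -invfM; congr (_^-1).
rewrite -!mulrnAr sqrtrM ?sqr_ge0// sqrtr_sqr gtr0_norm//.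
by rewrite expr1n mul1r.
Qed.

(* The Gaussian on the right has as precision the mean of the two precisions. *)
Lemma normal_pdf_geometric_mean w r x : 0 < r ->
  normal_pdf w r x * normal_pdf 0 1 x =
  normal_affinity_const w r *
  normal_pdf (w / (1 + r ^+ 2)) (Num.sqrt (2 * r ^+ 2 / (1 + r ^+ 2))) x ^+ 2.
Proof.
move=> r0; have r20 : 0 < 1 + r ^+ 2 by rewrite addr_gt0// exprn_gt0.
set v := 2 * r ^+ 2 / (1 + r ^+ 2).
have v0 : 0 < v by rewrite divr_gt0// mulr_gt0// exprn_gt0.
have sv0 : 0 < Num.sqrt v by rewrite sqrtr_gt0.
rewrite !normal_pdfE ?gt_eqF// (normal_peakV r0) (normal_peakV sv0).
rewrite /normal_fun /normal_affinity_const.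
(* [K] occurs squared on both sides, so what remains is a rational identity for the prefactors and
   one for the exponents. *)
set K := normal_peak 1.
rewrite !exprMn exprVn -expRM_natl (sqr_sqrtr (ltW v0)).
rewrite mulrACA -expRD [RHS]mulrACA -expRD; congr (_ * expR _).
  by rewrite /v; field; rewrite !gt_eqF.
by rewrite /v; field; rewrite !gt_eqF.
Qed.

(** With [u = w^2 / (1 + r^2)] the constant is [r^-1 (1 + u) exp(- u / 2)], and
    [(1 + u) (1 - u / 2) >= 1] because [u] lies in [[0, 1]]. *)
Lemma normal_affinity_const_ge w r : 0 < r -> r ^+ 2 = 1 + w ^+ 2 ->
  r^-1 <= normal_affinity_const w r.
Proof.
move=> r0 rw; have r20 : 0 < 1 + r ^+ 2 by rewrite addr_gt0// exprn_gt0.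
rewrite /normal_affinity_const.
have -> : 2 * r / (1 + r ^+ 2) = r^-1 * (1 + w ^+ 2 / (1 + r ^+ 2)).
  rewrite (_ : w ^+ 2 = r ^+ 2 - 1); last by rewrite rw; ring.
  by field; rewrite !gt_eqF.
set u := w ^+ 2 / (1 + r ^+ 2).
have u01 : 0 <= u <= 1.
  by rewrite divr_ge0 ?sqr_ge0 ?(ltW r20)//= ler_pdivrMr// mul1r rw; lra.
have -> : w ^+ 2 / (2 * (1 + r ^+ 2)) = u / 2.
  by rewrite /u; field; rewrite gt_eqF.
rewrite -[leLHS]mulr1 -mulrA ler_pM2l ?invr_gt0//.
apply: (@le_trans _ _ ((1 + u) * (1 - u / 2))); first by nra.
by rewrite ler_wpM2l ?expR_ge1Dx//; lra.
Qed.

End normal_geometric_mean.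

(** * From total variation to the width bound *)

Lemma lt_sqrt_powR (R : realType) (B w : R) n : (0 < n)%N -> 0 < B -> 0 < w ->
  w < Num.sqrt (B `^ (- (2 / n%:R)) - 1) ->
  B < (Num.sqrt (1 + w ^+ 2))^-1 ^+ n.
Proof.
move=> n0 B0 w0 wT; set r := Num.sqrt (1 + w ^+ 2).
have n0' : n%:R != 0 :> R by rewrite pnatr_eq0 -lt0n.
have D0 : 0 <= B `^ (- (2 / n%:R)) - 1.
  by rewrite ltW// -sqrtr_gt0; exact: lt_trans wT.
have r0 : 0 < r by rewrite sqrtr_gt0 ltr_pwDl// sqr_ge0.
have r2 : r ^+ 2 = 1 + w ^+ 2 by rewrite sqr_sqrtr// addr_ge0// sqr_ge0.
have lt1 : r ^+ 2 < B `^ (- (2 / n%:R)).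
  rewrite r2 -ltrBrDl -[ltRHS]sqr_sqrtr// ltr_pXn2r// nnegrE ?sqrtr_ge0//.
  exact: ltW.
have : (r ^+ n) ^+ 2 < (B^-1) ^+ 2.
  rewrite exprAC (_ : B^-1 ^+ 2 = (B `^ (- (2 / n%:R))) ^+ n).
    by rewrite ltr_pXn2r// nnegrE ?sqr_ge0 ?powR_ge0.
  rewrite -powR_mulrn ?powR_ge0// -powRrM mulNr divfK// powRN exprVn.
  by rewrite powR_mulrn// ltW.
rewrite ltr_pXn2r// ?nnegrE ?invr_ge0 ?exprn_ge0 ?ltW//.
by rewrite exprVn -ltf_pV2 ?posrE ?invr_gt0 ?exprn_gt0// invrK.
Qed.

Lemma normal_sample_sub_sqr_le (R : realType) (P1 P2 : normal_law R) n
    (A : set (n.-tuple (measurableTypeR R))) :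
  sd P1 ^+ 2 = 1 + mean P1 ^+ 2 -> mean P2 = 0 -> sd P2 = 1 -> measurable A ->
  (sd P1)^-1 ^+ n <=
  1 - (fine (sample_law n P1 A) - fine (sample_law n P2 A)) ^+ 2.
Proof.
case: P1 P2 => [w r r0] [m2 s2 s20] /= r2 m20 s21 mA; subst m2 s2.
have C1 := normal_affinity_const_ge r0 r2.
have C0 : 0 <= normal_affinity_const w r.
  by apply: le_trans C1; rewrite invr_ge0 ltW.
have Q : affinity_ge (normal_prob w r) (normal_prob 0 1)
    (normal_prob (w / (1 + r ^+ 2)) (Num.sqrt (2 * r ^+ 2 / (1 + r ^+ 2))))
    (normal_affinity_const w r).
  by apply: normal_affinity => // x; rewrite normal_pdf_geometric_mean.
apply: le_trans (iid_law_sub_sqr_le C0 Q mA).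
by rewrite lerXn2r// ?nnegrE// invr_ge0 ltW.
Qed.

Theorem corollary6p2 (R : realType) (n : nat) (alpha : R) :
  (1 <= n)%N -> 0 < alpha -> alpha < 1 / 3 ->
  ((Num.sqrt ((6 * alpha - 9 * alpha ^+ 2) `^ (- (2 / n%:R)) - 1))%:E
     <= minimax_width alpha n)%E.
Proof.
move=> n1 a0 a3; set B := 6 * alpha - 9 * alpha ^+ 2; set T := Num.sqrt _.
(* [B = 1 - (1 - 3 alpha)^2] lies strictly between 0 and 1, which makes [T] positive and leaves room
   for a positive [w] below it. *)
have B0 : 0 < B by rewrite /B; nra.
have B1 : B < 1 by rewrite /B; nra.
have BT : 1 < B `^ (- (2 / n%:R)).
  have e0 : 0 < 2 / n%:R :> R by rewrite divr_gt0// ltr0n.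
  rewrite powRN invf_gt1 ?powR_gt0//.
  have := gt0_ltr_powR e0 _ _ B1; rewrite powR1; apply; rewrite nnegrE//.
  exact: ltW.
have T0 : 0 < T by rewrite sqrtr_gt0 subr_gt0.
apply: le_ereal_inf_tmp => _ [CI [mL mU cov] <-].
rewrite leNgt; apply/negP => MT.
have [w w0 [wT Mw]] : exists2 w, 0 < w & w < T /\
  (ereal_sup [set (sd P)^-1%:E * width_quantile alpha CI P
             | P in [set: normal_law R]] < w%:E)%E.
  move: MT; set M := ereal_sup _; case: M => [M| |] //= MT.
  (* Truncating at 0 keeps [w] positive even if [M] is negative. *)
  - exists ((Num.max M 0 + T) / 2).
      by rewrite divr_gt0// ltr_wpDl// le_max lexx orbT.
    have : Num.max M 0 < T by rewrite gt_max T0 -lte_fin MT.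
    have : M <= Num.max M 0 by rewrite le_max lexx.
    rewrite lte_fin; lra.
  - by exists (T / 2); rewrite ?divr_gt0// ltNyr; split => //; lra.
set r := Num.sqrt (1 + w ^+ 2).
have r0 : 0 < r by rewrite sqrtr_gt0 ltr_pwDl// sqr_ge0.
have r2 : r ^+ 2 = 1 + w ^+ 2 by rewrite sqr_sqrtr// addr_ge0// sqr_ge0.
pose P1 := NormalLaw w r0; pose P2 := @NormalLaw R 0 1 ltr01.
(* As [sd P2 = 1], the quantile under [P2] is below [w], so [w] is not in the set whose supremum it
   is. *)
have narrow : (sample_law n P2 [set x | (w <= width CI x)%R] < alpha%:E)%E.
  rewrite ltNge; apply/negP => H.
  have : (w%:E <= width_quantile alpha CI P2)%E.
    by apply: ereal_sup_ubound; exists w.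
  have : ((sd P2)^-1%:E * width_quantile alpha CI P2 < w%:E)%E.
    by apply: le_lt_trans Mw; apply: ereal_sup_ubound; exists P2.
  by rewrite /= invr1 mul1e => /lt_le_trans /[apply]; rewrite ltxx.
have mcov m : measurable [set x | CI.1 x <= m <= CI.2 x].
  rewrite (_ : [set _ | _] = (CI.1 @^-1` `]-oo, m]) `&` (CI.2 @^-1` `[m, +oo[)).
    apply: measurableI; rewrite -[X in measurable X]setTI.
      exact: mL.
    exact: mU.
  by apply/seteqP; split => x /=; rewrite !in_itv/= andbT => /andP.
have mwid : measurable [set x | w <= width CI x].
  rewrite (_ : [set _ | _] = (width CI @^-1` `[w, +oo[)).
    rewrite -[X in measurable X]setTI.
    exact: (measurable_funB mU mL).
  by apply/seteqP; split => x /=; rewrite in_itv/= andbT.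
set E := [set x | CI.1 x <= w <= CI.2 x].
have mE : measurable E by exact: mcov.
have E1 : ((1 - alpha)%:E <= sample_law n P1 E)%E by exact: cov P1.
have E2 : (sample_law n P2 E <= (2 * alpha)%:E)%E.
  pose N := ~` [set x | CI.1 x <= 0 <= CI.2 x].
  have mN : measurable N by apply: measurableC; exact: mcov.
  have EN : E `<=` N `|` [set x | w <= width CI x].
    move=> x /= /andP[_ wU].
    have [/andP[L0 _]|/negP] := boolP (CI.1 x <= 0 <= CI.2 x); last by left.
    by right; rewrite /width; lra.
  have PN : (sample_law n P2 N <= alpha%:E)%E.
    rewrite probability_setC// leeBlDr// ?fin_num_measure//.
    by have := cov P2; rewrite EFinB leeBlDr// addeC.
  apply: (le_trans (le_measure _ _ _ EN)); rewrite ?inE//.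
    exact: measurableU.
  apply: (le_trans (measureU2 _ mN mwid)).
  rewrite (_ : 2 * alpha = alpha + alpha); last by ring.
  rewrite EFinD; apply: (leeD PN (ltW narrow)).
have TV : r^-1 ^+ n <= _ :=
  normal_sample_sub_sqr_le (P1 := P1) (P2 := P2) r2 erefl erefl mE.
have fP P : sample_law n P E = (fine (sample_law n P E))%:E.
  by rewrite fineK// fin_num_measure.
rewrite fP lee_fin in E1; rewrite fP lee_fin in E2.
have Br := lt_sqrt_powR n1 B0 w0 wT.
move: (fine (sample_law n P1 E)) (fine (sample_law n P2 E)) TV E1 E2.
move=> a b TV E1 E2.
(* Squaring [1 - 3 alpha <= a - b] is legitimate because [alpha < 1 / 3]. *)
have : (1 - 3 * alpha) ^+ 2 <= (a - b) ^+ 2.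
  by rewrite lerXn2r// ?nnegrE; lra.
by move: Br TV; rewrite -/r /B; lra.
Qed.
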